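(* Let $\mathbb{K}$ be the real algebra of octonions and let $\varPhi_{\widetilde M}:\mathbb{K}^4\times\mathbb{K}^4\to\mathbb{K}^7$ be the $\mathbb{R}$-bilinear map sending $((a_0,a_1,a_2,a_3),(b_0,b_1,b_2,b_3))$ to $(\hat c_0,\dots,\hat c_6)$, where $$\begin{aligned} \hat c_0&=a_0b_0-b_0a_0,\\ \hat c_1&=\overline{b_0}a_1+a_0\overline{b_1},\\ \hat c_2&=\overline{b_0}a_2+a_1b_1+a_0\overline{b_2},\\ \hat c_3&=b_0a_3+a_2\overline{b_1}-\overline{b_2}a_1+\overline{a_0}b_3,\\ \hat c_4&=a_3b_1+a_2b_2-b_3\overline{a_1}-3b_0a_0,\\ \hat c_5&=a_3b_2+a_2b_3,\\ \hat c_6&=a_3b_3. \end{aligned}$$ For each of the triples $$(h,k,m)\in\{(32,32,55),\,(32,26,54),\,(31,27,53),\,(29,29,51),\,(27,27,49),\,(26,30,52),\,(26,26,48),\,(25,32,48)\}$$ there exists a nonsingular bilinear map $\varPhi:\mathbb{R}^h\times\mathbb{R}^k\to\mathbb{R}^m$ obtained by restricting the domain and range of $\varPhi_{\widetilde M}$; that is, there are real linear subspaces $U,W\subset\mathbb{K}^4$ and $Y\subset\mathbb{K}^7$ with $\dim_{\mathbb{R}}U=h$, $\dim_{\mathbb{R}}W=k$, $\dim_{\mathbb{R}}Y=m$ and $\varPhi_{\widetilde M}(U\times W)\subset Y$, such that the restricted bilinear map $\varPhi_{\widetilde M}|:U\times W\to Y$ is nonsingular.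
   Context: $\mathbb{K}$ denotes the octonions, the classical 8-dimensional real normed division algebra (non-associative), with conjugation $x\mapsto\overline{x}$. Bilinear always means $\mathbb{R}$-bilinear, and $\mathbb{K}^n$ is regarded as a real vector space of dimension $8n$. A bilinear map $\varPhi:V\times W\to U$ of real vector spaces is nonsingular if $\varPhi(\overrightarrow{a},\overrightarrow{b})=\overrightarrow{0}$ implies $\overrightarrow{a}=\overrightarrow{0}$ or $\overrightarrow{b}=\overrightarrow{0}$. *)

(* Defs.v *)
From HB Require Import structures.
From mathcomp Require Import all_boot all_order all_algebra.
From mathcomp Require Import ring.
From mathcomp Require Import reals.

Set Implicit Arguments.
Unset Strict Implicit.
Unset Printing Implicit Defensive.

Import Order.TTheory GRing.Theory Num.Theory.
Local Open Scope ring_scope.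

(* (a, b) (c, d) = (a c - conj(d) b, d a + b conj(c)) *)
Definition cd_mul (A : zmodType) (mul : A -> A -> A) (conj : A -> A)
    (x y : A * A) : A * A :=
  (mul x.1 y.1 - mul (conj y.2) x.2, mul y.2 x.1 + mul x.2 (conj y.1)).

Definition cd_conj (A : zmodType) (conj : A -> A) (x : A * A) : A * A :=
  (conj x.1, - x.2).

Section Octonions.
Variable R : comNzRingType.

(* Octonions are stored by their coordinates on the standard basis, so that the *)
(* R-module structure is that of R^8. Product and conjugation come from three   *)
(* Cayley-Dickson doublings of R (with trivial conjugation).                    *)
Definition octonion : Type := 'rV[R]_8.
HB.instance Definition _ := Vector.copy octonion 'rV[R]_8.

Definition cd_octonion : Type :=
  ((R * R) * (R * R)) * ((R * R) * (R * R)).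

Definition oct_coord (x : octonion) (i : nat) : R := x 0 (inord i).

Definition oct_to_cd (x : octonion) : cd_octonion :=
  let c := oct_coord x in
  (((c 0, c 1), (c 2, c 3)), ((c 4, c 5), (c 6, c 7)))%N.

Definition oct_of_cd (z : cd_octonion) : octonion :=
  let: (((z0, z1), (z2, z3)), ((z4, z5), (z6, z7))) := z in
  \row_(i < 8) [:: z0; z1; z2; z3; z4; z5; z6; z7]`_i.

Definition oconj (x : octonion) : octonion :=
  oct_of_cd (cd_conj (cd_conj (cd_conj id)) (oct_to_cd x)).

Definition omul (x y : octonion) : octonion :=
  oct_of_cd
    (cd_mul (cd_mul (cd_mul *%R id) (cd_conj id)) (cd_conj (cd_conj id))
       (oct_to_cd x) (oct_to_cd y)).

Definition oone : octonion := oct_of_cd (((1, 0), (0, 0)), ((0, 0), (0, 0))).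

Definition onorm2 (x : octonion) : R := \sum_i x 0 i ^+ 2.

Lemma octP (x y : octonion) :
  (forall i, (i < 8)%N -> oct_coord x i = oct_coord y i) -> x = y.
Proof.
move=> exy; apply/rowP=> i; have := exy i (ltn_ord i).
by rewrite /oct_coord inord_val.
Qed.

Lemma oct_coord_of_cd z0 z1 z2 z3 z4 z5 z6 z7 i : (i < 8)%N ->
  oct_coord (oct_of_cd (((z0, z1), (z2, z3)), ((z4, z5), (z6, z7)))) i =
  [:: z0; z1; z2; z3; z4; z5; z6; z7]`_i.
Proof. by move=> lti; rewrite /oct_coord mxE inordK. Qed.

Lemma oct_coord_linear (k : R) (x y : octonion) i :
  oct_coord (k *: x + y) i = k * oct_coord x i + oct_coord y i.
Proof. by rewrite /oct_coord !mxE. Qed.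

Lemma oct_coordZ (k : R) (x : octonion) i :
  oct_coord (k *: x) i = k * oct_coord x i.
Proof. by rewrite /oct_coord mxE. Qed.

Lemma onorm2E (x : octonion) :
  onorm2 x = \sum_(0 <= i < 8) oct_coord x i ^+ 2.
Proof.
by rewrite big_mkord; apply: eq_bigr => i _; rewrite /oct_coord inord_val.
Qed.

Local Ltac oct_cases :=
  apply: octP; case=> [|[|[|[|[|[|[|[|?]]]]]]]] // _;
  rewrite ?oct_coord_linear ?oct_coordZ !oct_coord_of_cd //= ?oct_coord_linear.

Local Ltac oct_ring :=
  repeat match goal with
  | |- context [oct_coord ?x ?i] => is_var x; move: (oct_coord x i) => ?
  end; ring.

Lemma oconj_linear : linear oconj.
Proof. by move=> k x y; oct_cases; oct_ring. Qed.

Lemma omul_bilinear : bilinear_for *:%R *:%R omul.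
Proof. by split=> z k x y; rewrite /applyr; oct_cases; oct_ring. Qed.

HB.instance Definition _ := GRing.isLinear.Build R octonion octonion *:%R oconj
  oconj_linear.
HB.instance Definition _ := bilinear_isBilinear.Build R octonion octonion
  octonion *:%R *:%R omul omul_bilinear.

Lemma omul1o (x : octonion) : omul oone x = x.
Proof. by oct_cases; rewrite !oct_coord_of_cd //=; oct_ring. Qed.

Lemma omulo1 (x : octonion) : omul x oone = x.
Proof. by oct_cases; rewrite !oct_coord_of_cd //=; oct_ring. Qed.

Lemma onorm2M (x y : octonion) :
  onorm2 (omul x y) = onorm2 x * onorm2 y.
Proof.
rewrite !onorm2E !big_nat_recl // !big_nil !oct_coord_of_cd //=; oct_ring.
Qed.

Lemma omul_conj (x : octonion) : omul x (oconj x) = onorm2 x *: oone.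
Proof.
rewrite onorm2E !big_nat_recl // big_nil.
by oct_cases; rewrite !oct_coord_of_cd //=; oct_ring.
Qed.

End Octonions.

Arguments oconj {R}.
Arguments omul {R}.
Arguments oone {R}.

Lemma onorm2_eq0 (R : realType) (x : octonion R) : onorm2 x = 0 -> x = 0.
Proof.
move/eqP; rewrite psumr_eq0 => [/allP x0|i _]; last exact: sqr_ge0.
apply/rowP=> i; rewrite mxE; have := x0 i (mem_index_enum i).
by rewrite sqrf_eq0 => /eqP.
Qed.

Lemma dim_octonion (R : fieldType) : \dim {: octonion R} = 8.
Proof. by rewrite dimvf. Qed.

Definition nonsingular (F : nzRingType) (V W U : lmodType F)
    (f : {bilinear V -> W -> U}) : Prop :=
  forall a b, f a b = 0 -> a = 0 \/ b = 0.

Section Restriction.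
Variables (F : fieldType) (V1 V2 V3 : vectType F) (f : {bilinear V1 -> V2 -> V3}).
Variables (U : {vspace V1}) (W : {vspace V2}) (Y : {vspace V3}).

(* vsproj Y is the identity on Y, so this is the restriction of f to U x W with *)
(* values in Y as soon as f maps U x W into Y.                                  *)
Definition bilin_restrict (a : subvs_of U) (b : subvs_of W) : subvs_of Y :=
  vsproj Y (f (vsval a) (vsval b)).

Lemma bilin_restrict_bilinear : bilinear_for *:%R *:%R bilin_restrict.
Proof.
split=> z k x y; rewrite /applyr /bilin_restrict /=.
  by rewrite linearPl linearP.
by rewrite linearPr linearP.
Qed.

HB.instance Definition _ := bilinear_isBilinear.Build F (subvs_of U)
  (subvs_of W) (subvs_of Y) *:%R *:%R bilin_restrict bilin_restrict_bilinear.

End Restriction.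

Arguments bilin_restrict {F V1 V2 V3} f U W Y a b.

Section PhiM.
Variable R : comNzRingType.
Local Notation K := (octonion R).
Local Infix "**" := (@omul R) (at level 40, left associativity).
Local Notation cj := (@oconj R).

Definition phiM (a b : {ffun 'I_4 -> K}) : {ffun 'I_7 -> K} :=
  let a0 := a (inord 0) in let a1 := a (inord 1) in
  let a2 := a (inord 2) in let a3 := a (inord 3) in
  let b0 := b (inord 0) in let b1 := b (inord 1) in
  let b2 := b (inord 2) in let b3 := b (inord 3) in
  [ffun i : 'I_7 => nth 0 [::
    a0 ** b0 - b0 ** a0;
    cj b0 ** a1 + a0 ** cj b1;
    cj b0 ** a2 + a1 ** b1 + a0 ** cj b2;
    b0 ** a3 + a2 ** cj b1 - cj b2 ** a1 + cj a0 ** b3;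
    a3 ** b1 + a2 ** b2 - b3 ** cj a1 - 3%:R *: (b0 ** a0);
    a3 ** b2 + a2 ** b3;
    a3 ** b3] i].

Lemma phiM_bilinear : bilinear_for *:%R *:%R phiM.
Proof.
have li k u v (w : K) : (k *: u + v) ** w = k *: (u ** w) + v ** w.
  by rewrite linearPl.
have ri k u v (w : K) : w ** (k *: u + v) = k *: (w ** u) + w ** v.
  by rewrite linearPr.
have ci k (u v : K) : cj (k *: u + v) = k *: cj u + cj v by rewrite linearP.
have dD k (p q r s : K) : k *: p + q + (k *: r + s) = k *: (p + r) + (q + s).
  by rewrite scalerDr addrACA.
have dB k (p q r s : K) : k *: p + q - (k *: r + s) = k *: (p - r) + (q - s).
  by rewrite scalerBr opprD addrACA.
have d3 k (p q : K) : 3%:R *: (k *: p + q) = k *: (3%:R *: p) + 3%:R *: q.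
  by rewrite scalerDr !scalerA mulrC.
by split=> z k x y; apply/ffunP=> i; rewrite !ffunE;
  case: i => -[|[|[|[|[|[|[|i]]]]]]] //= _; rewrite !(ci, li, ri, d3, dD, dB).
Qed.

HB.instance Definition _ := bilinear_isBilinear.Build R {ffun 'I_4 -> K}
  {ffun 'I_4 -> K} {ffun 'I_7 -> K} *:%R *:%R phiM phiM_bilinear.

End PhiM.

Arguments phiM {R}.

(* Main.v *)
Require Import Defs.
From HB Require Import structures.
From mathcomp Require Import all_boot all_order all_algebra.
From mathcomp Require Import ring.
From mathcomp Require Import reals.

Set Implicit Arguments.
Unset Strict Implicit.
Unset Printing Implicit Defensive.

Import Order.TTheory GRing.Theory Num.Theory.
Local Open Scope ring_scope.

(** The map phiM is already nonsingular on the whole of K^4 x K^4; the eight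
    triples come from restricting only the coordinates a0 and b0.

    Nonsingularity. Suppose phiM a b = 0. The equation c0 says that a0 and
    b0 commute. Commuting octonions lie in one subalgebra R[z], and by
    Artin's theorem z and any further x generate an associative algebra; so
    products of a0, b0 and one other octonion can be rebracketed at will
    ([ocomm_assocl], [ocomm_assocr]). Put p = b0 a0. Since c6 = a3 b3,
    either a3 or b3 vanishes, and c5 then kills a2 or b2 as well unless a3 =
    b3 = 0. In each of the three cases left, the equations can be solved one
    after the other up to squared norms, until the last one reads t *: x =
    0, where x is a product of nonzero octonions as soon as p <> 0. The
    coefficient 3 of b0 a0 in c4 has the sign that makes t a sum of terms of
    the same sign, one of which is positive ([phiM_zero_b3], [phiM_zero_a3],
    [phiM_zero_inner]). Hence p = 0, and then the system unravels at once.

    Restriction. Only a0 and b0 enter the commutator c0 = a0 b0 - b0 a0. The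
    basis octonions satisfy e_i e_j = +- e_(i xor j), and e_0 is central, so
    if a0 and b0 are supported on the index sets A and B, then c0 is
    supported on the set C of all i xor j with i in A, j in B, both nonzero
    and distinct ([phiM_supp0]). This gives the dimensions (24 + |A|, 24 +
    |B|, 48 + |C|), and each triple is reached by a suitable choice of A and
    B. *)

Local Infix "**" := omul (at level 40, left associativity).
Local Notation cj := oconj.
Local Notation N := onorm2.

(** * Identities of the octonion algebra *)

Ltac oct_generalize :=
  repeat match goal with
  | |- context [oct_coord ?x ?i] => is_var x; move: (oct_coord x i) => ?
  end.

Ltac oct_ring :=
  rewrite ?onorm2E ?big_nat_recl ?big_nil //;
  apply: octP; case=> [|[|[|[|[|[|[|[|?]]]]]]]] // _;
  rewrite ?oct_coord_linear ?oct_coordZ ?oct_coord_of_cd //=;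
  rewrite ?oct_coord_linear ?oct_coordZ ?oct_coord_of_cd //=;
  oct_generalize; ring.

Section OctonionIdentities.
Variable R : comNzRingType.
Implicit Types (x y z a b : octonion R) (t : R).

(** The linearity of the product in each argument, spelled out on the head
    symbol [omul] so that these rules rewrite in both directions. *)
Lemma omulZl t x y : (t *: x) ** y = t *: (x ** y).
Proof. exact: linearZl_LR. Qed.

Lemma omulZr t x y : x ** (t *: y) = t *: (x ** y).
Proof. exact: linearZr_LR. Qed.

Lemma omulDl x y z : (x + y) ** z = x ** z + y ** z.
Proof. exact: linearDl. Qed.

Lemma omulDr x y z : z ** (x + y) = z ** x + z ** y.
Proof. exact: linearDr. Qed.

Lemma omulNl x y : (- x) ** y = - (x ** y).
Proof. exact: linearNl. Qed.

Lemma omulNr x y : y ** (- x) = - (y ** x).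
Proof. exact: linearNr. Qed.

Lemma omul0o x : 0 ** x = 0.
Proof. exact: linear0l. Qed.

Lemma omulo0 x : x ** 0 = 0.
Proof. exact: linear0r. Qed.

Lemma oconjZ t x : cj (t *: x) = t *: cj x.
Proof. exact: linearZ. Qed.

Lemma onorm2_0 : N (0 : octonion R) = 0.
Proof. by rewrite /onorm2 big1 // => i _; rewrite mxE expr0n. Qed.

Lemma oconjK x : cj (cj x) = x.
Proof. by oct_ring. Qed.

Lemma oconjM x y : cj (x ** y) = cj y ** cj x.
Proof. by oct_ring. Qed.

Lemma onorm2_conj x : N (cj x) = N x.
Proof.
by rewrite !onorm2E !big_nat_recl // !big_nil !oct_coord_of_cd //= !sqrrN.
Qed.

Lemma omulKl a x : cj a ** (a ** x) = N a *: x.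
Proof. by oct_ring. Qed.

Lemma omulVKl a x : a ** (cj a ** x) = N a *: x.
Proof. by rewrite -{1}(oconjK a) omulKl onorm2_conj. Qed.

Lemma omulKr a x : (x ** a) ** cj a = N a *: x.
Proof.
by apply: (can_inj oconjK); rewrite !oconjM linearZ /= -omulVKl oconjK.
Qed.

Lemma omulVKr a x : (x ** cj a) ** a = N a *: x.
Proof. by rewrite -{2}(oconjK a) omulKr onorm2_conj. Qed.

Lemma oconjE a : cj a = (2%:R * oct_coord a 0) *: oone - a.
Proof. by rewrite -scaleN1r addrC; oct_ring. Qed.

(** Multiplying by cj a = t - a on the left turns the norm identity [omulKl]
    into a quadratic equation for left multiplication by a, which a itself
    also satisfies. *)
Lemma oaltl a x : (a ** a) ** x = a ** (a ** x).
Proof.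
have [t cja] : exists t, cj a = t *: oone - a by eexists; apply: oconjE.
have sqE y : a ** (a ** y) = t *: (a ** y) - N a *: y.
  by rewrite -omulKl cja omulDl omulNl omulZl omul1o subKr.
rewrite -{2}[a]omulo1 sqE omulo1.
by rewrite omulDl omulNl !omulZl omul1o sqE.
Qed.

(** The commutator is twice the cross product of the imaginary parts in R^7,
    and Lagrange's identity gives its norm by the 2 x 2 minors. *)
Lemma onorm2_comm a b :
  onorm2 (a ** b - b ** a) = 2%:R * \sum_(0 <= i < 7) \sum_(0 <= j < 7)
    (oct_coord a i.+1 * oct_coord b j.+1 -
     oct_coord a j.+1 * oct_coord b i.+1) ^+ 2.
Proof.
rewrite -scaleN1r addrC onorm2E.
rewrite unlock /= !oct_coord_linear !oct_coord_of_cd //=.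
oct_generalize; ring.
Qed.

(** The basis octonions satisfy e_i e_j = +- e_(i xor j), and distinct
    imaginary ones anticommute: each pair i, j contributes to coordinate i
    xor j only. *)
Lemma ocomm_coord_eq0 x y k : (k < 8)%N ->
  (forall i j, (0 < i < 8)%N -> (0 < j < 8)%N -> i != j -> Nat.lxor i j = k ->
     oct_coord x i * oct_coord y j = 0) ->
  oct_coord (x ** y - y ** x) k = 0.
Proof.
move=> lt_k8 xy0.
have pair0 i j : [&& (0 < i < 8)%N, (0 < j < 8)%N, i != j,
      Nat.lxor i j == k & Nat.lxor j i == k] ->
    oct_coord x i * oct_coord y j = 0 /\ oct_coord x j * oct_coord y i = 0.
  case/and5P=> ri rj ij /eqP ijk /eqP jik.
  by split; apply: xy0; rewrite // eq_sym.
rewrite -scaleN1r addrC {xy0}.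
case: k lt_k8 pair0 => [|[|[|[|[|[|[|[|?]]]]]]]] // _ pair0;
  rewrite oct_coord_linear !oct_coord_of_cd //=; first by oct_generalize; ring.
(* the lines of the Fano plane through e_k, for k = 1, ..., 7 *)
all: [> move: (pair0 2 3 isT) (pair0 4 5 isT) (pair0 6 7 isT)
      | move: (pair0 1 3 isT) (pair0 4 6 isT) (pair0 5 7 isT)
      | move: (pair0 1 2 isT) (pair0 4 7 isT) (pair0 5 6 isT)
      | move: (pair0 1 5 isT) (pair0 2 6 isT) (pair0 3 7 isT)
      | move: (pair0 1 4 isT) (pair0 2 7 isT) (pair0 3 6 isT)
      | move: (pair0 1 7 isT) (pair0 2 4 isT) (pair0 3 5 isT)
      | move: (pair0 1 6 isT) (pair0 2 5 isT) (pair0 3 4 isT)].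
all: by oct_generalize => -[h1 h2] [h3 h4] [h5 h6]; ring: h1 h2 h3 h4 h5 h6.
Qed.

End OctonionIdentities.

(** * Commuting octonions *)

Section RealOctonions.
Variable R : realType.
Implicit Types (x a b : octonion R) (t : R).

Lemma onorm2_gt0 x : (0 < N x) = (x != 0).
Proof.
rewrite lt0r sumr_ge0 ?andbT => [|i _]; last exact: sqr_ge0.
congr negb; apply/eqP/eqP => [/onorm2_eq0|->] //.
by rewrite onorm2_0.
Qed.

Lemma omul_eq0 x y : x ** y = 0 -> x = 0 \/ y = 0.
Proof.
move=> /(congr1 (@onorm2 R))/eqP; rewrite onorm2M.
by rewrite onorm2_0 mulf_eq0 => /orP[] /eqP/onorm2_eq0 ->; [left | right].
Qed.

(** When a is not a real scalar, the minors vanish only if the imaginary part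
    of b is a real multiple of that of a. *)
Lemma ocomm_span a b : a ** b = b ** a ->
  (exists s, a = s *: oone) \/ (exists s t, b = s *: oone + t *: a).
Proof.
move=> /eqP; rewrite -subr_eq0 => /eqP ab0.
have minor0 i j : (i < 7)%N -> (j < 7)%N ->
    oct_coord a i.+1 * oct_coord b j.+1 = oct_coord a j.+1 * oct_coord b i.+1.
  move=> ri rj; move: (onorm2_comm a b).
  rewrite ab0 onorm2_0 => /esym/eqP.
  rewrite mulf_eq0 pnatr_eq0 /= psumr_eq0 => [|k _].
    move=> /allP/(_ i); rewrite mem_index_iota ri => /(_ isT)/=.
    rewrite psumr_eq0 => [|k _]; last exact: sqr_ge0.
    move=> /allP/(_ j); rewrite mem_index_iota rj => /(_ isT)/=.
    by rewrite sqrf_eq0 subr_eq0 => /eqP.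
  by apply: sumr_ge0 => l _; apply: sqr_ge0.
have [/allP im0|/allPn[i]] :=
    boolP (all (fun i => oct_coord a i.+1 == 0) (iota 0 7)).
  left; exists (oct_coord a 0); apply: octP => -[_|k lt_k8];
    rewrite oct_coordZ oct_coord_of_cd ?mulr1 //.
  have /eqP -> : oct_coord a k.+1 == 0 by apply: im0; rewrite mem_iota.
  by case: k lt_k8 => [|[|[|[|[|[|[|?]]]]]]] //= _; rewrite mulr0.
rewrite mem_iota => /= lt_i7 ai0; right.
pose t := oct_coord b i.+1 / oct_coord a i.+1.
exists (oct_coord b 0 - t * oct_coord a 0), t; apply: octP => -[_|k lt_k8];
  rewrite oct_coord_linear oct_coordZ oct_coord_of_cd //=.
  by rewrite mulr1 subrK.
have -> : [:: 0; 0; 0; 0; 0; 0; 0]`_k = 0 :> R.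
  by case: k lt_k8 => [|[|[|[|[|[|[|?]]]]]]].
rewrite mulr0 add0r /t mulrAC [_ * oct_coord a _]mulrC -(minor0 i k) //.
by rewrite mulrC mulKf.
Qed.

(** By [ocomm_span] only a scalar and an alternative law intervene; this is
    Artin's theorem in the case needed for the system phiM a b = 0. *)
Lemma ocomm_assocl a b x : a ** b = b ** a -> (a ** b) ** x = a ** (b ** x).
Proof.
move=> /ocomm_span[[s ->]|[s [t ->]]].
  by rewrite !(omulZl, omul1o).
by rewrite !(omulDl, omulDr, omulZl, omulZr, omul1o, omulo1) oaltl.
Qed.

Lemma ocomm_assocr a b x : a ** b = b ** a -> (x ** a) ** b = x ** (a ** b).
Proof.
move=> ab; apply: (can_inj (@oconjK R)); rewrite !oconjM ocomm_assocl //.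
by rewrite -!oconjM ab.
Qed.

(** * Nonsingularity on the whole space *)

Lemma scale_pos_eq0 t x : 0 < t -> t *: x = 0 -> x = 0.
Proof. by move=> t0 /eqP; rewrite scaler_eq0 gt_eqF //= => /eqP. Qed.

(** The two equations c0 = 0 and c1 = 0 determine b1 from a0, b0, a1 when a0
    is invertible, and a1 from a0, b0, b1 when b0 is. Scaling by norms in
    place of dividing keeps the identities valid for all arguments. *)
Lemma solve_b1 a0 b0 a1 b1 :
  a0 ** b0 = b0 ** a0 -> cj b0 ** a1 + a0 ** cj b1 = 0 ->
  N a0 *: b1 = - (cj a1 ** (b0 ** a0)).
Proof.
move=> comm0 /addr0_eq/(congr1 (@oconj R)).
rewrite raddfN /= !oconjM !oconjK => e.
by rewrite -omulVKr -e omulNl ocomm_assocr.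
Qed.

Lemma solve_a1 a0 b0 a1 b1 :
  a0 ** b0 = b0 ** a0 -> cj b0 ** a1 + a0 ** cj b1 = 0 ->
  N b0 *: a1 = - ((b0 ** a0) ** cj b1).
Proof.
move=> comm0 /eqP; rewrite addr_eq0 => /eqP e.
by rewrite -omulVKl e omulNr ocomm_assocl.
Qed.

(** Here a2 = a3 = 0. For a0 <> 0, solving c1, c2, c3 for b1, b2, b3 turns
    c4 into (N a1 ^+ 2 + 3 * N a0 ^+ 2) *: p = 0 with p = b0 ** a0. *)
Lemma phiM_zero_b3 a0 a1 b0 b1 b2 b3 : b3 != 0 ->
  a0 ** b0 = b0 ** a0 ->
  cj b0 ** a1 + a0 ** cj b1 = 0 ->
  a1 ** b1 + a0 ** cj b2 = 0 ->
  cj b2 ** a1 = cj a0 ** b3 ->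
  b3 ** cj a1 + 3%:R *: (b0 ** a0) = 0 ->
  a0 = 0 /\ a1 = 0.
Proof.
move=> b3n0 comm0 c1 c2 c3 c4.
have p0 : b0 ** a0 = 0.
  have [->|a0n0] := eqVneq a0 0; first by rewrite linear0r.
  have Na0 : N a0 != 0 by rewrite gt_eqF ?onorm2_gt0.
  have e1 := solve_b1 comm0 c1.
  have e2 : N a0 *: cj b2 = N a1 *: b0.
    apply: (scalerI Na0); rewrite -[in LHS]omulKl -omulZr.
    move/eqP: c2; rewrite addrC addr_eq0 => /eqP ->.
    rewrite scalerN -omulZr e1 !omulNr opprK omulVKl.
    by rewrite omulZr /= -comm0 omulKl scalerA mulrC -scalerA.
  have e3 : N a0 ^+ 2 *: b3 = N a1 *: ((b0 ** a0) ** a1).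
    rewrite expr2 -scalerA -[N a0 *: b3]omulVKl -c3 -omulZr /=.
    by rewrite -omulZl e2 omulZl omulZr /= -ocomm_assocl // comm0.
  apply: (@scale_pos_eq0 (N a1 ^+ 2 + 3%:R * N a0 ^+ 2)).
    by rewrite ltr_wpDl ?sqr_ge0 // mulr_gt0 ?exprn_gt0 ?onorm2_gt0.
  have e4 : N a0 ^+ 2 *: (b3 ** cj a1) = N a1 ^+ 2 *: (b0 ** a0).
    by rewrite -(omulZl (N a0 ^+ 2)) e3 omulZl omulKr scalerA.
  rewrite scalerDl -e4 [3%:R * _]mulrC -(scalerA (N a0 ^+ 2)) -scalerDr.
  by rewrite c4 scaler0.
move/eqP: c4; rewrite p0 scaler0 addr0.
move=> /eqP/omul_eq0[/eqP|/(congr1 (@oconj R))].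
  by rewrite (negPf b3n0).
rewrite oconjK linear0 => a10; split=> //.
move: c3; rewrite a10 linear0r => /esym/omul_eq0[/(congr1 (@oconj R))|/eqP].
  by rewrite oconjK linear0.
by rewrite (negPf b3n0).
Qed.

(** The mirror case b2 = b3 = 0. For b0 <> 0, solving c1, c2, c3 for a1, a2,
    a3 turns c4 into (N b1 ^+ 2 + 3 * N b0 ^+ 2) *: p = 0 with p = b0 ** a0. *)
Lemma phiM_zero_a3 a0 a1 a2 a3 b0 b1 : a3 != 0 ->
  a0 ** b0 = b0 ** a0 ->
  cj b0 ** a1 + a0 ** cj b1 = 0 ->
  cj b0 ** a2 + a1 ** b1 = 0 ->
  b0 ** a3 + a2 ** cj b1 = 0 ->
  a3 ** b1 = 3%:R *: (b0 ** a0) ->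
  b0 = 0 /\ b1 = 0.
Proof.
move=> a3n0 comm0 c1 c2 c3 c4.
have p0 : b0 ** a0 = 0.
  have [->|b0n0] := eqVneq b0 0; first by rewrite linear0l.
  have Nb0 : N b0 != 0 by rewrite gt_eqF ?onorm2_gt0.
  have e1 := solve_a1 comm0 c1.
  set p := b0 ** a0 in e1 c4 *.
  have b0p : b0 ** p = p ** b0 by rewrite /p -{1}comm0 ocomm_assocl.
  have e2 : N b0 ^+ 2 *: a2 = N b1 *: (b0 ** p).
    have e : N b0 *: (cj b0 ** a2) = N b1 *: p.
      move/eqP: c2; rewrite addr_eq0 => /eqP ->.
      by rewrite scalerN -(omulZl (N b0)) e1 omulNl opprK omulVKr.
    by rewrite expr2 -scalerA -[N b0 *: a2]omulVKl -(omulZr (N b0)) e omulZr.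
  have e3 : N b0 ^+ 2 *: a3 = - (N b1 *: (p ** cj b1)).
    apply: (scalerI Nb0); rewrite -[in LHS]omulKl omulZr.
    move/eqP: c3; rewrite addr_eq0 => /eqP ->.
    rewrite scalerN -(omulZl (N b0 ^+ 2)) e2 omulZl ocomm_assocl //.
    by rewrite omulNr omulZr omulKl scalerN !scalerA mulrC.
  apply: (@scale_pos_eq0 (N b1 ^+ 2 + 3%:R * N b0 ^+ 2)).
    by rewrite ltr_wpDl ?sqr_ge0 // mulr_gt0 ?exprn_gt0 ?onorm2_gt0.
  have e4 : N b0 ^+ 2 *: (a3 ** b1) = - (N b1 ^+ 2 *: p).
    by rewrite -(omulZl (N b0 ^+ 2)) e3 omulNl omulZl omulVKr scalerA.
  by rewrite scalerDl [3%:R * _]mulrC -(scalerA (N b0 ^+ 2)) -c4 e4 subrr.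
move/eqP: c4; rewrite p0 scaler0 => /eqP/omul_eq0[/eqP|b10].
  by rewrite (negPf a3n0).
split=> //; move: c3; rewrite b10 linear0 linear0r addr0 => /omul_eq0[] // /eqP.
by rewrite (negPf a3n0).
Qed.

(** Here a3 = b3 = 0. Suppose that p = b0 ** a0 is not 0. The equation c4
    gives cj b2 as a positive multiple of cj p ** a2, and c2 then gives a2
    as a nonnegative multiple of b0 ** p (as a2 <> 0, this forces a1 <> 0).
    Both sides of c3 become multiples of b0 ** a1, by a negative factor on
    the left and a positive one on the right, although b0 and a1 do not
    vanish. *)
Lemma phiM_zero_inner a0 a1 a2 b0 b1 b2 :
  a0 ** b0 = b0 ** a0 ->
  cj b0 ** a1 + a0 ** cj b1 = 0 ->
  cj b0 ** a2 + a1 ** b1 + a0 ** cj b2 = 0 ->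
  a2 ** cj b1 = cj b2 ** a1 ->
  a2 ** b2 = 3%:R *: (b0 ** a0) ->
  b0 ** a0 = 0.
Proof.
move=> comm0 c1 c2 c3 c4; apply/eqP/negPn/negP => p_neq0.
have e1 := solve_b1 comm0 c1.
have : a2 != 0.
  apply: contraNneq p_neq0 => a20; move/eqP: c4.
  by rewrite a20 linear0l eq_sym scaler_eq0 pnatr_eq0.
have : b0 != 0 by apply: contraNneq p_neq0 => ->; rewrite linear0l.
have : a0 != 0 by apply: contraNneq p_neq0 => ->; rewrite linear0r.
rewrite -!onorm2_gt0 => Na0 Nb0 Na2.
move: (p_neq0); rewrite -onorm2_gt0 => Np.
set p := b0 ** a0 in e1 c4 p_neq0 Np *.
have b0p : b0 ** p = p ** b0 by rewrite /p -{1}comm0 ocomm_assocl.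
have cjp : cj a0 ** cj b0 = cj b0 ** cj a0 by rewrite -!oconjM comm0.
have e2 : N a2 *: cj b2 = 3%:R *: (cj p ** a2).
  by rewrite -oconjZ /= -omulKl c4 omulZr oconjZ /= oconjM oconjK.
have e3 : N a0 *: (a1 ** b1) = - (N a1 *: p).
  by rewrite -(omulZr (N a0)) e1 omulNr omulVKl.
(* up to a positive factor, r is the distance between the factors of the two
   sides of c3; s clears the denominators in the formula for a2 *)
pose r := N a2 + 3%:R * N a0; pose s := N a0 * (r * N b0).
have r_gt0 : 0 < r by rewrite addr_gt0 ?mulr_gt0.
have e4 : s *: a2 = (N a1 * N a2) *: (b0 ** p).
  have e : N a2 *: (a0 ** cj b2) = (3%:R * N a0) *: (cj b0 ** a2).
    by rewrite -(omulZr (N a2)) e2 omulZr /p oconjM ocomm_assocl // omulVKl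
      scalerA.
  have e' : r *: (cj b0 ** a2) = - (N a2 *: (a1 ** b1)).
    apply/eqP; rewrite -addr_eq0 scalerDl -e -!scalerDr.
    by rewrite addrAC c2 scaler0.
  have -> : s *: a2 = N a0 *: (b0 ** (r *: (cj b0 ** a2))).
    by rewrite omulZr omulVKl !scalerA /s mulrA.
  rewrite e' omulNr omulZr scalerN scalerA mulrC -(scalerA (N a2)).
  rewrite -(omulZr (N a0)) e3.
  by rewrite omulNr scalerN opprK omulZr scalerA mulrC.
have s_gt0 : 0 < s by rewrite !mulr_gt0.
have Na1 : 0 < N a1.
  rewrite onorm2_gt0; apply: contraTneq Na2 => a10; rewrite onorm2_gt0 negbK.
  apply/eqP/(scale_pos_eq0 s_gt0); rewrite e4 a10.
  by rewrite onorm2_0 mul0r scale0r.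
have e5 : (N a1 * N a2 * N p * r) *: (b0 ** a1) = 0.
  have ecj : N a0 *: cj b1 = - (cj p ** a1).
    by rewrite -oconjZ e1 raddfN /= oconjM oconjK.
  have lhs : s *: (N a0 *: (a2 ** cj b1)) =
      - ((N a1 * N a2 * N p) *: (b0 ** a1)).
    rewrite -(omulZr (N a0)) ecj omulNr scalerN -(omulZl s) e4 omulZl.
    by rewrite ocomm_assocl // omulVKl omulZr scalerA.
  have rhs : s *: (N a2 *: (cj b2 ** a1)) =
      (3%:R * (N a1 * N a2 * N p)) *: (b0 ** a1).
    rewrite -(omulZl (N a2)) e2 omulZl [LHS]scalerA [s * _]mulrC -[LHS]scalerA.
    rewrite -(omulZl s) -(omulZr s) e4 omulZr omulZl b0p omulKl omulZl.
    by rewrite !scalerA; congr (_ *: _); ring.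
  have -> : N a1 * N a2 * N p * r =
    N a2 * (N a1 * N a2 * N p) + N a0 * (3%:R * (N a1 * N a2 * N p)).
    by rewrite /r; ring.
  rewrite scalerDl -(scalerA (N a2)) -(scalerA (N a0)) -rhs.
  rewrite -[(N a1 * N a2 * N p) *: _]opprK -lhs c3 scalerN !scalerA.
  by rewrite addrC -scalerBl (_ : _ - _ = 0) ?scale0r //; ring.
have /omul_eq0[b00|a10] : b0 ** a1 = 0.
- by apply: scale_pos_eq0 e5; rewrite !mulr_gt0.
- by rewrite b00 onorm2_0 ltxx in Nb0.
- by rewrite a10 onorm2_0 ltxx in Na1.
Qed.

Lemma ffun4_eq0 (a : {ffun 'I_4 -> octonion R}) :
  a (inord 0) = 0 -> a (inord 1) = 0 -> a (inord 2) = 0 -> a (inord 3) = 0 ->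
  a = 0.
Proof.
move=> z0 z1 z2 z3; apply/ffunP=> i; rewrite ffunE -(inord_val i).
by case: i => [[|[|[|[|?]]]]].
Qed.

(** The equation c6 makes a3 or b3 vanish. The cases where exactly one of
    them does follow from [phiM_zero_a3] and [phiM_zero_b3]; when both do,
    [phiM_zero_inner] and c4 leave a2 = 0 or b2 = 0, and the rest is
    cancellation. *)
Lemma phiM_nonsingular : nonsingular (@phiM R).
Proof.
move=> a b ab0.
have c i := congr1 (fun f : {ffun _} => f (inord i)) ab0.
have := (c 0, c 1, c 2, c 3, (c 4, c 5, c 6))%N.
rewrite !ffunE !inordK //= => {c ab0}.
have z4 := @ffun4_eq0 a; have z4' := @ffun4_eq0 b.
move: (a (inord 0)) (a (inord 1)) (a (inord 2)) (a (inord 3)) z4.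
move: (b (inord 0)) (b (inord 1)) (b (inord 2)) (b (inord 3)) z4'.
move=> b0 b1 b2 b3 bE a0 a1 a2 a3 aE.
move=> [[[[/subr0_eq c0 c1] c2] c3] [[c4 c5] c6]].
have [a3_0|a3n0] := eqVneq a3 0; last first.
  have b3_0 : b3 = 0 by case: (omul_eq0 c6) => // /eqP; rewrite (negPf a3n0).
  move: c5; rewrite b3_0 omulo0 addr0 => /omul_eq0[/eqP|b2_0].
    by rewrite (negPf a3n0).
  move: c2 c3 c4.
  rewrite b3_0 b2_0 linear0 !(omul0o, omulo0) !(addr0, subr0).
  move=> c2 c3 /subr0_eq c4.
  by have [? ?] := phiM_zero_a3 a3n0 c0 c1 c2 c3 c4; right; apply: bE.
have [b3_0|b3n0] := eqVneq b3 0; last first.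
  move: c5; rewrite a3_0 omul0o add0r => /omul_eq0[a2_0|/eqP]; last first.
    by rewrite (negPf b3n0).
  move: c2 c3 c4.
  rewrite a3_0 a2_0 !(omul0o, omulo0) !(add0r, addr0) => c2 c3 c4.
  have {}c3 : cj b2 ** a1 = cj a0 ** b3.
    by apply/esym/subr0_eq; rewrite addrC.
  have {}c4 : b3 ** cj a1 + 3%:R *: (b0 ** a0) = 0.
    by apply: oppr_inj; rewrite opprD oppr0.
  by have [? ?] := phiM_zero_b3 b3n0 c0 c1 c2 c3 c4; left; apply: aE.
move: c3 c4; rewrite a3_0 b3_0 !(omul0o, omulo0) !(add0r, addr0, subr0).
move=> /subr0_eq c3 /subr0_eq c4.
have p0 := phiM_zero_inner c0 c1 c2 c3 c4.
move: c4; rewrite p0 scaler0 => c4.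
have cj0 x : cj x = 0 -> x = 0 by move=> x0; rewrite -[x]oconjK x0 linear0.
have [a2_0|a2n0] := eqVneq a2 0; last first.
  have b2_0 : b2 = 0 by case: (omul_eq0 c4) => // /eqP; rewrite (negPf a2n0).
  move: c3; rewrite b2_0 linear0 omul0o => /omul_eq0[/eqP|/cj0 b1_0].
    by rewrite (negPf a2n0).
  move: c2; rewrite b1_0 b2_0 linear0 !omulo0 !addr0.
  case/omul_eq0=> [/cj0 b0_0|/eqP].
    by right; apply: bE.
  by rewrite (negPf a2n0).
move: c2 c3; rewrite a2_0 omulo0 omul0o add0r => c2 /esym c3.
have [a0_0|a0n0] := eqVneq a0 0.
  have [a1_0|a1n0] := eqVneq a1 0; first by left; apply: aE.
  have a1I x : x ** a1 = 0 -> x = 0.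
    by case/omul_eq0 => // /eqP; rewrite (negPf a1n0).
  move: c1 c2; rewrite a0_0 !omul0o !addr0.
  move=> /a1I/cj0 b0_0 /omul_eq0[/eqP|b1_0].
    by rewrite (negPf a1n0).
  by right; apply: bE => //; apply/cj0/a1I.
have a0I x : a0 ** x = 0 -> x = 0.
  by case/omul_eq0 => // /eqP; rewrite (negPf a0n0).
have b0_0 : b0 = 0 by apply: a0I; rewrite c0.
move: c1; rewrite b0_0 linear0 omul0o add0r => /a0I/cj0 b1_0.
by move: c2; rewrite b1_0 omulo0 add0r => /a0I/cj0 b2_0; right; apply: bE.
Qed.

End RealOctonions.

(** * Restricting the first coordinates *)

Section Support.
Variable R : fieldType.
Local Notation K := (octonion R).

Definition off_supp n (s : seq nat) (f : {ffun 'I_n.+1 -> K}) :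
    'rV[R]_#|[pred i : 'I_8 | val i \notin s]| :=
  \row_j f ord0 0 (enum_val j).

Lemma off_supp_linear n s : linear (@off_supp n s).
Proof. by move=> k f g; apply/rowP=> j; rewrite !mxE !ffunE !mxE. Qed.

HB.instance Definition _ n s := GRing.isLinear.Build R {ffun 'I_n.+1 -> K}
  'rV[R]_#|[pred i : 'I_8 | val i \notin s]| *:%R (@off_supp n s)
  (@off_supp_linear n s).

Definition supp0 n s : {vspace {ffun 'I_n.+1 -> K}} :=
  lker (linfun (@off_supp n s)).

Lemma mem_supp0 n (s : seq nat) (f : {ffun 'I_n.+1 -> K}) :
  reflect (forall i, (i < 8)%N -> i \notin s -> oct_coord (f ord0) i = 0)
    (f \in supp0 n s).
Proof.
rewrite memv_ker lfunE; apply: (iffP eqP) => [/rowP f0 i lti si|f0].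
  have Pi : (inord i : 'I_8) \in [pred i : 'I_8 | val i \notin s].
    by rewrite inE /= inordK.
  by have := f0 (enum_rank_in Pi (inord i)); rewrite !mxE enum_rankK_in.
apply/rowP=> j; rewrite !mxE -[enum_val j]inord_val.
by apply: f0 (ltn_ord _) _; have := enum_valP j; rewrite inE.
Qed.

Lemma dim_supp0 n (s : seq nat) :
  \dim (supp0 n s) = (8 * n + count [in s] (iota 0 8))%N.
Proof.
have := limg_ker_dim (linfun (@off_supp n s)) fullv; rewrite capfv.
have -> : limg (linfun (@off_supp n s)) = fullv.
  apply/vspaceP=> v; rewrite memvf; apply/memv_imgP.
  (* any values at the indices outside s are taken, by x extended by 0 on s *)
  pose x : K := \row_i \sum_(j | enum_val j == i) v 0 j.
  exists [ffun=> x]; first exact: memvf.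
  apply/rowP=> j; rewrite lfunE !mxE ffunE mxE (big_pred1 j) // => i /=.
  by rewrite (inj_eq enum_val_inj).
have card8 :
    (count [in s] (iota 0 8) + #|[pred i : 'I_8 | val i \notin s]| = 8)%N.
  rewrite [X in (_ + X)%N]cardE size_filter -enumT.
  have -> : count [pred i : 'I_8 | val i \notin s] (enum 'I_8) =
      count (predC [in s]) (iota 0 8).
    by rewrite -val_enum_ord [RHS]count_map; apply: eq_count.
  exact: count_predC.
rewrite -/(supp0 n s) !dimvf /dim /= card_ord /dim /= !mul1n => dims.
apply/eqP; rewrite -(eqn_add2r #|[pred i : 'I_8 | val i \notin s]|).
by rewrite dims -addnA card8 mulSn addnC mulnC.
Qed.

(** The terms with i = 0 or j = 0 are dropped because e_0 is central, those
    with i = j because e_i commutes with itself. *)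
Definition comm_within (A B C : seq nat) : bool :=
  all (fun i => all (fun j =>
    [&& 0 < i, 0 < j & i != j]%N ==> (Nat.lxor i j \in C)) B) A.

Lemma phiM_supp0 (A B C : seq nat) (a b : {ffun 'I_4 -> octonion R}) :
  comm_within A B C -> a \in supp0 3 A -> b \in supp0 3 B ->
  phiM a b \in supp0 6 C.
Proof.
move=> ABC /mem_supp0 aA /mem_supp0 bB; apply/mem_supp0 => k lt_k8 kC.
rewrite ffunE /= (_ : inord 0 = ord0); last by apply/val_inj; rewrite /= inordK.
apply: ocomm_coord_eq0 => // i j /andP[i0 i8] /andP[j0 j8] ij ijk.
have [iA|/(aA i i8)->] := boolP (i \in A); last by rewrite mul0r.
have [jB|/(bB j j8)->] := boolP (j \in B); last by rewrite mulr0.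
have /allP/(_ j jB) := allP ABC i iA.
by rewrite i0 j0 ij ijk (negPf kC).
Qed.

End Support.

Lemma bilin_restrict_nonsingular (F : fieldType) (V1 V2 V3 : vectType F)
    (f : {bilinear V1 -> V2 -> V3}) (U : {vspace V1}) (W : {vspace V2})
    (Y : {vspace V3}) :
  (forall a b, a \in U -> b \in W -> f a b \in Y) ->
  nonsingular f -> nonsingular (bilin_restrict f U W Y).
Proof.
move=> fY f_ns a b /(congr1 vsval).
rewrite /= vsprojK ?fY ?subvsP // => /f_ns[a0|b0]; [left | right];
  exact: subvs_inj.
Qed.

Theorem proposition6p2 (R : realType) (h k m : nat)
    (hkm : (h, k, m) \in
       [:: (32, 32, 55); (32, 26, 54); (31, 27, 53); (29, 29, 51);
           (27, 27, 49); (26, 30, 52); (26, 26, 48); (25, 32, 48)]%N) :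
  exists (U W : {vspace {ffun 'I_4 -> octonion R}})
         (Y : {vspace {ffun 'I_7 -> octonion R}}),
    [/\ \dim U = h, \dim W = k, \dim Y = m,
        (forall a b, a \in U -> b \in W -> phiM a b \in Y)
      & nonsingular (bilin_restrict (F := R) phiM U W Y)].
Proof.
suff [A [B [C [ABC [-> [-> ->]]]]]] : exists A B C : seq nat,
    comm_within A B C /\
    (h = 8 * 3 + count [in A] (iota 0 8) /\
     k = 8 * 3 + count [in B] (iota 0 8) /\
     m = 8 * 6 + count [in C] (iota 0 8))%N.
  have UWY a b : a \in supp0 R 3 A -> b \in supp0 R 3 B ->
    phiM a b \in supp0 R 6 C by apply: phiM_supp0.
  exists (supp0 R 3 A), (supp0 R 3 B), (supp0 R 6 C).
  split; rewrite ?dim_supp0 //.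
  exact: bilin_restrict_nonsingular (@phiM_nonsingular R).
move: hkm; rewrite !inE.
case/or4P => [|||/or4P[|||/orP[]]] /eqP[-> -> ->].
- by exists (iota 0 8), (iota 0 8), (iota 1 7).
- by exists (iota 0 8), (iota 0 2), (iota 2 6).
- by exists [:: 0; 1; 2; 4; 5; 6; 7]%N, (iota 0 3), (iota 3 5).
(* 4, ..., 7 span the complement of the quaternion subalgebra on 0, ..., 3, and
   two elements of this complement multiply into that subalgebra. *)
- by exists [:: 0; 4; 5; 6; 7]%N, [:: 0; 4; 5; 6; 7]%N, (iota 1 3).
- by exists (iota 0 3), (iota 0 3), [:: 3]%N.
- by exists (iota 0 2), [:: 0; 1; 4; 5; 6; 7]%N, (iota 4 4).
- by exists (iota 0 2), (iota 0 2), [::].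
- by exists [:: 0]%N, (iota 0 8), [::].
Qed.
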